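(* Let $G$ be a discrete group, let $n\ge2$, and let $\alpha=(A,\{\alpha_t\}_{t\in G})$ be an $n$-filling action of $G$ on a unital $C^*$-algebra $A$ such that for every non-zero projection $p\in A$ the algebra $pAp$ is infinite dimensional. Let $\mathcal{B}$ be the Fell bundle corresponding to $\alpha$. Then the action $\alpha$ is minimal (there are no non-trivial $\alpha$-invariant ideals in $A$) and every element $a\in A^+\setminus\{0\}$ is strictly $\mathcal{B}$-infinite and residually strictly $\mathcal{B}$-infinite.
   Context: Ideals in $C^*$-algebras are closed and two-sided; products such as $aX$, $aXa$ of elements and subspaces denote closed linear spans of products. A (global) action $\alpha$ of $G$ on a unital $C^*$-algebra $A$ by automorphisms $\alpha_t$ is $n$-filling, $n\ge2$, if for all $b_1,\dots,b_n\in A^+$ of norm one and all $\varepsilon>0$ there exist $g_1,\dots,g_n\in G$ such that $\sum_{i=1}^n\alpha_{g_i}(b_i)\ge1-\varepsilon$. The Fell bundle $\mathcal{B}=\{B_t\}_{t\in G}$ of $\alpha$ is $B_t=\{a\delta_t:a\in A\}$ (isometric to $A$; $\delta_t$ a formal marker), with $(a\delta_t)(b\delta_s)=a\alpha_t(b)\delta_{ts}$ and $(a\delta_t)^*=\alpha_{t^{-1}}(a^* )\delta_{t^{-1}}$; $B_e$ is identified with $A$ ($e$ the unit of $G$). An ideal in $\mathcal{B}$ is a collection $\mathcal{J}=\{J_t\}_{t\in G}$ of closed subspaces $J_t\subseteq B_t$ with $B_sJ_t\subseteq J_{st}$ and $J_sB_t\subseteq J_{st}$; then $\mathcal{B}/\mathcal{J}=\{B_t/J_t\}_{t\in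 G}$ is a Fell bundle. For a Fell bundle $\mathcal{B}$, an element $a\in B_e^+\setminus\{0\}$ is strictly $\mathcal{B}$-infinite if there are a non-zero positive $b\in aB_ea$ and elements $a_i\in aB_{t_i}$, $t_i\in G$, $i=1,\dots,k$ (some finite $k$), such that $a=\sum_{i}a_i^*a_i$, $a_i^*a_j=0$ for $i\neq j$, and $a_i^*b=0$ for all $i$. It is residually strictly $\mathcal{B}$-infinite if for every ideal $\mathcal{J}$ in $\mathcal{B}$ the element $a+J_e$ is either zero in $B_e/J_e$ or strictly $\mathcal{B}/\mathcal{J}$-infinite. *)

(* Defs.v *)
From HB Require Import structures.
From mathcomp Require Import all_boot all_order all_algebra.
From mathcomp Require Import all_classical all_reals topology normedtype.
From mathcomp Require Import complex.

Set Implicit Arguments.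
Unset Strict Implicit.
Unset Printing Implicit Defensive.

Import Order.TTheory GRing.Theory Num.Theory.
Import numFieldNormedType.Exports.

Local Open Scope classical_set_scope.
Local Open Scope ring_scope.
Local Open Scope complex_scope.
Local Open Scope quotient_scope.

(* Unital normed algebras over the complex numbers R[i].  A single structure
   inheriting both from algType and from normedModType is rejected by
   Hierarchy Builder (no common join with numDomainType), so the algebra lives
   on A, and its norm and topology on the alias nspace A, which is
   convertible to A.  Being an algType, A is nonzero. *)
HB.mixin Record isNormedAlgebra (R : realType) A & GRing.Algebra R[i] A := {
  anorm : A -> R;
  ler_anormD : forall a b : A, anorm (a + b) <= anorm a + anorm b;
  anormZ : forall (k : R[i]) (a : A), (anorm (k *: a))%:C = `|k| * (anorm a)%:C;
  anorm0_eq0 : forall a : A, anorm a = 0 -> a = 0;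
  ler_anormM : forall a b : A, anorm (a * b) <= anorm a * anorm b
}.

#[short(type="normedAlgType")]
HB.structure Definition NormedAlgebra (R : realType) :=
  {A of GRing.Algebra R[i] A & isNormedAlgebra R A}.

Definition nspace (R : realType) (A : normedAlgType R) : Type := A.

Section NormedSpaceOfAlgebra.
Variables (R : realType) (A : normedAlgType R).

HB.instance Definition _ := GRing.Lmodule.on (nspace A).

Let cnorm (a : nspace A) : R[i] := (anorm (a : A))%:C.

Let cnormD (a b : nspace A) : cnorm (a + b) <= cnorm a + cnorm b.
Proof. by rewrite /cnorm -rmorphD/= lecR; exact: ler_anormD. Qed.

Let cnormZ (k : R[i]) (a : nspace A) : cnorm (k *: a) = `|k| * cnorm a.
Proof. exact: anormZ. Qed.

Let cnorm0_eq0 (a : nspace A) : cnorm a = 0 -> a = 0.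
Proof. by move=> [] /anorm0_eq0. Qed.

HB.instance Definition _ :=
  Lmodule_isNormed.Build R[i] (nspace A) cnormD cnormZ cnorm0_eq0.

End NormedSpaceOfAlgebra.

HB.mixin Record NormedAlgebra_isCstar (R : realType) A & NormedAlgebra R A := {
  cstar_cauchy_cvg : forall F : set_system (nspace A),
    ProperFilter F -> cauchy F -> cvg F;
  star : A -> A;
  starK : involutive star;
  starD : {morph star : a b / a + b};
  starZ : forall (k : R[i]) (a : A), star (k *: a) = conjc k *: star a;
  starM : forall a b : A, star (a * b) = star b * star a;
  anorm_starM : forall a : A, anorm (star a * a) = anorm a ^+ 2
}.

#[short(type="cstarAlgType")]
HB.structure Definition CstarAlgebra (R : realType) :=
  {A of NormedAlgebra R A & NormedAlgebra_isCstar R A}.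

HB.instance Definition _ (R : realType) (A : cstarAlgType R) :=
  Uniform_isComplete.Build (nspace A) cstar_cauchy_cvg.

Section Subspaces.
Variables (R : realType) (V : normedModType R[i]).

Definition lspan (X : set V) : set V :=
  [set v | exists (n : nat) (c : 'I_n -> R[i]) (x : 'I_n -> V),
     (forall i, X (x i)) /\ v = \sum_(i < n) c i *: x i].

Definition cspan (X : set V) : set V := closure (lspan X).

Definition infinite_dimensional (W : set V) : Prop :=
  ~ exists (n : nat) (e : 'I_n -> V), W = lspan (range e).

Record closedSubspace := ClosedSubspace {
  carrier :> V -> Prop;
  carrier_closed : closed carrier;
  carrier0 : carrier 0;
  carrierD : forall x y, carrier x -> carrier y -> carrier (x + y);
  carrierZ : forall (k : R[i]) x, carrier x -> carrier (k *: x)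
}.

Variable W : closedSubspace.

Definition carrier_pred : {pred V} := fun x => `[< W x >].

Let carrier_pred_zmod_closed : zmod_closed carrier_pred.
Proof.
split=> [|x y]; rewrite /carrier_pred !unfold_in.
  by apply/asboolP; exact: carrier0.
move=> /asboolP Wx /asboolP Wy; apply/asboolP.
by apply: carrierD => //; rewrite -scaleN1r; exact: carrierZ.
Qed.

HB.instance Definition _ :=
  GRing.isZmodClosed.Build V carrier_pred carrier_pred_zmod_closed.

Definition quotSpace : Type := Quotient.quot carrier_pred.

HB.instance Definition _ := GRing.Zmodule.on quotSpace.

Definition qpi (x : V) : quotSpace := \pi_(Quotient.quot carrier_pred) x.
Definition qrepr (x : quotSpace) : V :=
  repr (x : Quotient.quot carrier_pred).

Lemma qreprK x : qpi (qrepr x) = x. Proof. exact: reprK. Qed.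

Lemma qpi_eq x y : qpi x = qpi y <-> W (x - y).
Proof.
rewrite /qpi; split=> [/eqP|Wxy]; last apply/eqP; rewrite piE.
  by rewrite Quotient.equivE => /asboolP.
by rewrite Quotient.equivE; apply/asboolP.
Qed.

Lemma qpiD x y : qpi (x + y) = qpi x + qpi y.
Proof. by rewrite /qpi; exact: (raddfD \pi_(Quotient.quot carrier_pred)). Qed.

Lemma qpi0 : qpi 0 = 0.
Proof. by rewrite /qpi; exact: (raddf0 \pi_(Quotient.quot carrier_pred)). Qed.

Let qscale (k : R[i]) (x : quotSpace) : quotSpace := qpi (k *: qrepr x).

Let qscale_pi k x : qscale k (qpi x) = qpi (k *: x).
Proof.
by apply/qpi_eq; rewrite -scalerBr; apply: carrierZ; apply/qpi_eq/qreprK.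
Qed.

Let qscaleA a b v : qscale a (qscale b v) = qscale (a * b) v.
Proof. by rewrite -(qreprK v) !qscale_pi scalerA. Qed.

Let qscale1 : left_id 1 qscale.
Proof. by move=> v; rewrite -(qreprK v) qscale_pi scale1r. Qed.

Let qscaleDr : right_distributive qscale +%R.
Proof.
move=> a u v; rewrite -(qreprK u) -(qreprK v) !(qscale_pi, =^~ qpiD).
by rewrite scalerDr.
Qed.

Let qscaleDl v : {morph qscale^~ v : a b / a + b}.
Proof. by move=> a b; rewrite -(qreprK v) !qscale_pi scalerDl qpiD. Qed.

HB.instance Definition _ := GRing.Zmodule_isLmodule.Build R[i] quotSpace
  qscaleA qscale1 qscaleDr qscaleDl.

Lemma qpiZ k x : qpi (k *: x) = k *: qpi x.
Proof. by rewrite -qscale_pi. Qed.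

Definition qnorm (x : quotSpace) : R :=
  inf [set complex.Re `|v| | v in [set v : V | qpi v = x]].

End Subspaces.

Section QuotientNorm.
Variables (R : realType) (V : normedModType R[i]) (W : closedSubspace V).

Let norms (x : quotSpace W) : set R :=
  [set complex.Re `|v| | v in [set v : V | qpi W v = x]].

Let norm_Re (v : V) : (complex.Re `|v|)%:C = `|v|.
Proof. by rewrite RRe_real ?normr_real. Qed.

Let norm_Re_ge0 (v : V) : 0 <= complex.Re `|v|.
Proof. by rewrite -lecR norm_Re (normr_ge0 v). Qed.

Let normsP x : has_inf (norms x).
Proof.
split; first by exists (complex.Re `|qrepr x|), (qrepr x) => //=; exact: qreprK.
by exists 0 => _ [v _ <-].
Qed.

Let qnorm_le v : (qnorm (qpi W v))%:C <= `|v|.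
Proof.
rewrite -norm_Re lecR.
by apply: ge_inf; [exact: (normsP _).2 | exists v].
Qed.

Let qnorm_approx x (e : R) : 0 < e ->
  exists2 v, qpi W v = x & `|v| < (qnorm x + e)%:C.
Proof.
move=> e0; have [_ [v vx <-] ve] := inf_adherent e0 (normsP x).
by exists v => //; rewrite -norm_Re ltcR.
Qed.

Let cqnorm x : R[i] := (qnorm (W := W) x)%:C.

Let qnorm_ge0 (x : quotSpace W) : 0 <= qnorm x.
Proof.
apply: lb_le_inf; first exact: (normsP x).1.
by move=> _ [v _ <-].
Qed.

Let cqnormD x y : cqnorm (x + y) <= cqnorm x + cqnorm y.
Proof.
rewrite /cqnorm -rmorphD/= lecR; apply/ler_addgt0Pl => e e0.
have e20 : 0 < e / 2 by rewrite divr_gt0.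
have [v <- vx] := qnorm_approx x e20.
have [w <- wy] := qnorm_approx y e20.
rewrite -lecR -qpiD (le_trans (qnorm_le _))// (le_trans (ler_normD _ _))//.
rewrite (le_trans (lerD (ltW vx) (ltW wy)))// -rmorphD/= lecR.
by rewrite addrACA -splitr addrC.
Qed.

Let cqnormZ_le k x : cqnorm (k *: x) <= `|k| * cqnorm x.
Proof.
have [->|k0] := eqVneq k 0.
  rewrite scale0r normr0 mul0r /cqnorm -(qpi0 W).
  by rewrite (le_trans (qnorm_le _))// normr0.
have [r kR] : exists r : R, `|k| = r%:C.
  by exists (complex.Re `|k|); rewrite RRe_real ?normr_real.
have r0 : 0 < r by rewrite -ltcR -kR normr_gt0.
rewrite kR /cqnorm -rmorphM/= lecR; apply/ler_addgt0Pr => e e0.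
have [v <- vx] := qnorm_approx x (divr_gt0 e0 r0).
rewrite -qpiZ -lecR (le_trans (qnorm_le _))// normrZ kR.
apply: (@le_trans _ _ (r%:C * (qnorm (qpi W v) + e / r)%:C)).
  by rewrite ler_pM2l ?ltcR//; exact: ltW.
rewrite -rmorphM/= lecR.
by rewrite mulrDr mulrCA divff ?mulr1// gt_eqF.
Qed.

Let cqnormZ k x : cqnorm (k *: x) = `|k| * cqnorm x.
Proof.
apply/eqP; rewrite eq_le cqnormZ_le/=.
have [->|k0] := eqVneq k 0.
  by rewrite normr0 mul0r; have := qnorm_ge0 (0 *: x); rewrite -lecR.
rewrite -ler_pdivlMl ?normr_gt0// -normfV.
by rewrite (le_trans _ (cqnormZ_le _ _))// scalerA mulVf// scale1r.
Qed.

Let cqnorm0_eq0 x : cqnorm x = 0 -> x = 0.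
Proof.
move=> [] x0; rewrite -(qreprK x) -(qpi0 W); apply/qpi_eq; rewrite subr0.
apply: carrier_closed => B /nbhs_ballP[e /= e0 eB].
have eR : e = (complex.Re e)%:C by rewrite RRe_real// gtr0_real.
have Re0 : 0 < complex.Re e by rewrite -ltcR -eR.
have [v vx ve] := qnorm_approx x Re0.
exists (qrepr x - v); split.
  by apply/qpi_eq; rewrite qreprK.
apply: eB; rewrite -ball_normE /= opprB addrC subrK.
by rewrite eR (lt_le_trans ve)// x0 add0r.
Qed.

HB.instance Definition _ :=
  Lmodule_isNormed.Build R[i] (quotSpace W) cqnormD cqnormZ cqnorm0_eq0.

End QuotientNorm.

Section Bundles.
Variables (R : realType) (G : groupType).

(* The operations of a Fell bundle over G, on normed fibers.  [bmul] takes a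
   proof of s * t = u so that, for instance, x^* x lands in the unit fiber
   for every x.  The Fell bundle axioms play no role in the definition of
   strictly infinite elements and are not recorded, so that the quotient by an
   ideal is defined without first proving that it is a Fell bundle. *)
Record bundle := Bundle {
  fiber :> G -> normedModType R[i];
  bmul : forall s t u : G, (s * t)%g = u -> fiber s -> fiber t -> fiber u;
  bstar : forall t : G, fiber t -> fiber (t^-1)%g
}.

Section BundleTheory.
Variable B : bundle.

Definition emul (a b : B 1%g) : B 1%g := bmul (mulg1 1%g) a b.

Definition emull (t : G) (a : B 1%g) (x : B t) : B t := bmul (mul1g t) a x.

(* x^* y in the unit fiber, for x and y in the same fiber *)
Definition estarM (t : G) (x y : B t) : B 1%g := bmul (mulVg t) (bstar x) y.

Definition epositive (a : B 1%g) : Prop := exists x : B 1%g, a = estarM x x.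

Definition strictly_infinite (a : B 1%g) : Prop :=
  [/\ epositive a, a <> 0 &
  exists b : B 1%g,
    [/\ epositive b, b <> 0,
        cspan [set emul (emul a c) a | c in setT] b &
    exists (k : nat) (t : 'I_k -> G) (x : forall i : 'I_k, B (t i)),
      [/\ forall i, cspan [set emull a y | y in setT] (x i),
          a = \sum_(i < k) estarM (x i) (x i),
          forall i j, i != j ->
            bmul (erefl ((t i)^-1 * t j)%g) (bstar (x i)) (x j) = 0 &
          forall i, bmul (mulg1 (t i)^-1)%g (bstar (x i)) b = 0]]].

Definition fiber_prod (s t u : G) (E : (s * t)%g = u)
    (X : set (B s)) (Y : set (B t)) : set (B u) :=
  cspan [set bmul E x y | x in X & y in Y].

Record bundle_ideal := BundleIdeal {
  ifiber :> forall t : G, closedSubspace (B t);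
  ideal_mull : forall (s t u : G) (E : (s * t)%g = u),
    fiber_prod E setT (ifiber t) `<=` ifiber u;
  ideal_mulr : forall (s t u : G) (E : (s * t)%g = u),
    fiber_prod E (ifiber s) setT `<=` ifiber u
}.

(* The operations are computed on representatives: ideals absorb products and,
   in a Fell bundle, they are stable under the involution, so the class of the
   result does not depend on the representatives. *)
Definition quot_bundle (J : bundle_ideal) : bundle := {|
  fiber := fun t => quotSpace (J t) : normedModType R[i];
  bmul := fun s t u E x y => qpi (J u) (bmul E (qrepr x) (qrepr y));
  bstar := fun t x => qpi (J (t^-1)%g) (bstar (qrepr x))
|}.

End BundleTheory.

Definition residually_strictly_infinite (B : bundle) (a : B 1%g) : Prop :=
  forall J : bundle_ideal B,
    qpi (J 1%g) a = 0 \/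
    strictly_infinite (B := quot_bundle J) (qpi (J 1%g) a).

End Bundles.

Section Actions.
Variables (R : realType) (A : cstarAlgType R).

Definition positive (a : A) : Prop := exists x : A, a = star x * x.

Definition projection (p : A) : Prop := star p = p /\ p * p = p.

Definition corner (p : A) : set (nspace A) :=
  cspan (V := nspace A) [set p * a * p | a in [set: A]].

Variable G : groupType.

Record action := Action {
  act :> G -> {lrmorphism A -> A};
  act_star : forall (t : G) (a : A), act t (star a) = star (act t a);
  act1 : forall a : A, act 1%g a = a;
  actM : forall (s t : G) (a : A), act (s * t)%g a = act s (act t a)
}.

Variable alpha : action.

Definition filling (n : nat) : Prop :=
  forall b : 'I_n -> A, (forall i, positive (b i) /\ anorm (b i) = 1) ->
  forall eps : R, 0 < eps -> exists g : 'I_n -> G,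
    positive (\sum_(i < n) alpha (g i) (b i) - (1 - eps)%:C%:A).

Definition minimal : Prop :=
  forall I : closedSubspace (nspace A),
    (forall a x : A, I x -> I (a * x : A)) ->
    (forall x a : A, I x -> I (x * a : A)) ->
    (forall (t : G) (x : A), I x -> I (alpha t x)) ->
    carrier I = [set 0] \/ carrier I = setT.

(* The fiber over t is A itself, an element a standing for a delta_t. *)
Definition action_bundle : bundle R G := {|
  fiber := fun _ => nspace A : normedModType R[i];
  bmul := fun s _ _ _ (a b : A) => a * alpha s b;
  bstar := fun t (a : A) => alpha (t^-1)%g (star a)
|}.

End Actions.

(* Main.v *)
Require Import Defs.
From mathcomp Require Import all_boot all_order all_algebra.
From mathcomp Require Import all_classical all_reals topology normedtype.
From mathcomp Require Import complex ring lra.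

Set Implicit Arguments.
Unset Strict Implicit.
Unset Printing Implicit Defensive.

Import Order.TTheory GRing.Theory Num.Theory.
Import numFieldNormedType.Exports.

Local Open Scope ring_scope.
Local Open Scope complex_scope.

(** Why the theorem holds.  In an n-filling system, any n positive elements of
    norm 1 have translates with sum S >= 1/2, so there is a self-adjoint w with
    w S w = 1 (inverse_sqrt).  An invariant ideal containing a nonzero element
    contains such an S, hence 1: the action is minimal (filling_minimal).

    Let a = star x * x be nonzero.  If a A a contains n + 1 pairwise orthogonal
    nonzero self-adjoint elements f 0, ..., f n, apply the previous remark to the
    normalized squares of f 1, ..., f n: then a = star x w S w x splits into n
    summands star z * z, with z in a B_t, the different z being orthogonal to each
    other and to the square of f 0, which witnesses that a is strictly infinite
    (filling_strictly_infinite).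

    The orthogonal elements come from the infinite-dimensional corners
    (orthogonal_family).  If a corner r A r does not contain two orthogonal nonzero
    self-adjoint elements, every self-adjoint element of it has a sign, since
    otherwise its positive and negative parts would split it.  Applied to k - t p
    for all real t, this makes k proportional to p by a Dedekind cut
    (proportional_of_sign).  So r r is a multiple of a projection p and p A p is
    the line spanned by p, which is excluded.

    Finally, by minimality an ideal of the bundle either contains the whole unit
    fiber, so that a vanishes in the quotient, or is zero, so that the quotient
    map preserves strict infiniteness (strictly_infinite_quot0).

    The order theory this needs is developed without spectra.  A self-adjoint h
    is a square exactly when the norm of t - h is at most t for some real t
    (sqrt_exists, sqr_dist_le); so squares are closed under sums and limits.  The
    square roots commute with the commutant of h, which gives moduli and, through
    them, the fundamental fact that star y * y is a square (sasquare_star_mul). *)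

(** * Norm, involution and completeness *)

Section CstarAlgebra.
Variables (R : realType) (A : cstarAlgType R).
Implicit Types (a b c d h k p r s : A) (t : R).

Lemma normrC t : `|t%:C| = `|t|%:C :> R[i].
Proof. by rewrite normc_def /= expr0n addr0 sqrtr_sqr. Qed.

Lemma anormZr t a : anorm (t%:C *: a) = `|t| * anorm a.
Proof.
by have := anormZ t%:C a; rewrite normrC -rmorphM => -[].
Qed.

Lemma anormN a : anorm (- a) = anorm a.
Proof. by rewrite -scaleN1r -(rmorphN1 (real_complex R)) anormZr normrN1 mul1r. Qed.

Lemma anorm0 : anorm (0 : A) = 0.
Proof. by rewrite -(scale0r (0 : A)) anormZr normr0 mul0r. Qed.

Lemma anorm_ge0 a : 0 <= anorm a.
Proof. by have := ler_anormD a (- a); rewrite subrr anorm0 anormN; lra. Qed.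

Lemma anormB a b : anorm (a - b) = anorm (b - a).
Proof. by rewrite -anormN opprB. Qed.

Lemma anorm_eq0 a : (anorm a == 0) = (a == 0).
Proof. by apply/eqP/eqP => [/anorm0_eq0|->] //; exact: anorm0. Qed.

Lemma anorm_gt0 a : a <> 0 -> 0 < anorm a.
Proof. by move=> /eqP a0; rewrite lt_def anorm_eq0 a0 anorm_ge0. Qed.

Lemma ler_anormB a b : anorm (a - b) <= anorm a + anorm b.
Proof. by rewrite -(anormN b); exact: ler_anormD. Qed.

Lemma ler_anorm_dist a b e : anorm (a - b) <= e -> anorm a <= anorm b + e.
Proof. by have := ler_anormD (a - b) b; rewrite subrK; lra. Qed.

Lemma anorm_small_eq0 a : (forall e : R, 0 < e -> anorm a <= e) -> a = 0.
Proof.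
move=> small; apply: anorm0_eq0; apply/eqP; rewrite eq_le anorm_ge0 andbT.
by apply/ler_addgt0Pr => e e0; rewrite add0r small.
Qed.

Definition converges_to (u : nat -> A) (l : A) : Prop :=
  forall e : R, 0 < e -> exists N, forall n, (N <= n)%N -> anorm (u n - l) <= e.

(** Completeness is only ever used through this comparison with a bounded real
    sequence, which replaces summing a majorizing series. *)
Lemma majorized_converges (u : nat -> A) (v : nat -> R) (M : R) :
    (forall n, anorm (u n.+1 - u n) <= v n.+1 - v n) ->
    (forall n, v n <= M) ->
  exists l, converges_to u l.
Proof.
move=> uv vM.
have diff N n : (N <= n)%N -> anorm (u n - u N) <= v n - v N.
  move=> /subnK <-; elim: (n - N)%N => [|d IH].
    by rewrite add0n !subrr anorm0.
  rewrite addSn -(subrK (u (d + N)) (u _.+1)) -addrA.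
  have := ler_anormD (u (d + N).+1 - u (d + N)%N) (u (d + N)%N - u N).
  by have := uv (d + N)%N; lra.
have hs : has_sup (range v).
  by split; [exists (v 0%N), 0%N | exists M => _ [n _ <-]].
have tail e : 0 < e -> exists N, forall n, (N <= n)%N -> anorm (u n - u N) < e.
  move=> e0; have [_ [N _ <-] vN] := sup_adherent e0 hs.
  exists N => n /diff; have : v n <= sup (range v).
    by apply: ub_le_sup; [case: hs | exists n].
  by move: vN; lra.
have /cstar_cauchy_cvg/cvg_ex[l ul] :
    cauchy ((fun n => u n : nspace A) @ \oo)%classic.
  apply: cauchy_exP => e e0.
  have eR : e = (complex.Re e)%:C by rewrite RRe_real// gtr0_real.
  have [|N uN] := tail (complex.Re e); first by rewrite -ltcR -eR.
  exists (u N); exists N => // n /= Nn; rewrite -ball_normE /= eR.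
  by rewrite distrC ltcR; exact: uN.
exists l => e e0.
have eC0 : 0 < e%:C :> R[i] by rewrite ltcR.
have /cvgrPdistC_le/(_ _ eC0)[N _ uN] := ul.
exists N => n Nn; have := uN n Nn.
by rewrite /= lecR.
Qed.

Lemma converges_norm (u : nat -> A) l M :
  converges_to u l -> (forall n, anorm (u n) <= M) -> anorm l <= M.
Proof.
move=> ul uM; apply/ler_addgt0Pr => e /ul[N uN].
have := uN _ (leqnn N); rewrite anormB => /ler_anorm_dist.
by have := uM N; lra.
Qed.

Lemma converges_comm (u : nat -> A) l b :
  converges_to u l -> (forall n, GRing.comm b (u n)) -> GRing.comm b l.
Proof.
move=> ul bu; apply/subr0_eq/anorm_small_eq0 => e e0.
have d0 : 0 < 2 * anorm b + 1 by have := anorm_ge0 b; lra.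
have [N uN] := ul _ (divr_gt0 e0 d0).
rewrite (_ : _ - _ = b * (l - u N) - (l - u N) * b); last first.
  by rewrite mulrBr mulrBl bu opprB addrA subrK.
have := uN _ (leqnn N); rewrite anormB ler_pdivlMr// => le.
have := ler_anormB (b * (l - u N)) ((l - u N) * b).
have := ler_anormM b (l - u N); have := ler_anormM (l - u N) b.
by have := anorm_ge0 (l - u N); lra.
Qed.

Lemma star0 : star (0 : A) = 0.
Proof. by apply: (addrI (star 0)); rewrite -starD !addr0. Qed.

Lemma starN a : star (- a) = - star a.
Proof. by apply: (addrI (star a)); rewrite -starD !subrr star0. Qed.

Lemma starB a b : star (a - b) = star a - star b.
Proof. by rewrite starD starN. Qed.

Lemma star1 : star (1 : A) = 1.
Proof. by rewrite -[LHS]mulr1 -{2}(starK 1) -starM mulr1 starK. Qed.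

Lemma starZr t a : star (t%:C *: a) = t%:C *: star a.
Proof. by rewrite starZ conjc_real. Qed.

Lemma starZi a : star ('i%C *: a) = - 'i%C *: star a.
Proof.
rewrite starZ; congr (_ *: _); apply/eqP.
by rewrite eq_complex /= oppr0 !eqxx.
Qed.

Lemma anorm_star a : anorm (star a) = anorm a.
Proof.
suff le b : anorm b <= anorm (star b).
  by apply/eqP; rewrite eq_le le -{2}(starK a) le.
have [->|/eqP b0] := eqVneq b 0; first by rewrite star0.
have := ler_anormM (star b) b; rewrite anorm_starM expr2.
by rewrite ler_pM2r// anorm_gt0.
Qed.

Lemma anorm1 : anorm (1 : A) = 1.
Proof.
have := anorm_starM (1 : A); rewrite star1 mulr1 expr2 => /eqP.
rewrite -{1}(mulr1 (anorm 1)) (inj_eq (mulfI _)); first by move/eqP.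
by rewrite anorm_eq0 oner_eq0.
Qed.

Lemma anorm_scalar t : anorm (t%:C%:A : A) = `|t|.
Proof. by rewrite anormZr anorm1 mulr1. Qed.

Definition selfadjoint a := star a = a.

Lemma anorm_sqr a : selfadjoint a -> anorm (a * a) = anorm a ^+ 2.
Proof. by move=> sa; rewrite -{1}sa anorm_starM. Qed.

Lemma converges_selfadjoint (u : nat -> A) l :
  converges_to u l -> (forall n, selfadjoint (u n)) -> selfadjoint l.
Proof.
move=> ul su; apply/subr0_eq/anorm_small_eq0 => e e0.
have e20 : 0 < e / 2 by lra.
have [N uN] := ul _ e20; have := uN _ (leqnn N).
have := ler_anormB (l - u N) (star (l - u N)).
rewrite anorm_star anormB starB su opprB addrA subrK.
by rewrite anormB (anormB (u N)); lra.
Qed.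

(** * Inverses and square roots by the method of majorants *)

(** The method of majorants: iterating F from 0 is controlled, step by step, by
    iterating f from 0 on the reals, where the iterates increase and stay below
    M.  The fixed point comes with its approximating sequence, so that it
    inherits self-adjointness and commutation relations from the iterates.
    It yields both inverses (F x = 1 + z x) and square roots
    (F x = (z + x x) / 2). *)
Lemma majorant_fixpoint (F : A -> A) (f : R -> R) (M L : R) :
    0 <= M -> 0 < L -> 0 <= f 0 -> anorm (F 0) <= f 0 ->
    (forall s : R, 0 <= s -> s <= M -> f s <= M) ->
    (forall x y (s t : R), 0 <= t -> t <= s -> s <= M ->
       anorm x <= s -> anorm y <= t -> anorm (x - y) <= s - t ->
       anorm (F x - F y) <= f s - f t) ->
    (forall x y, anorm x <= M -> anorm y <= M ->
       anorm (F x - F y) <= L * anorm (x - y)) ->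
  exists w, [/\ F w = w, anorm w <= M & converges_to (fun n => iter n F 0) w].
Proof.
move=> M0 L0 f0 F0 fM Ff FL.
pose u n := iter n F 0; pose v n := iter n f 0.
have uv n : [/\ 0 <= v n, v n <= v n.+1, v n.+1 <= M, anorm (u n) <= v n
              & anorm (u n.+1 - u n) <= v n.+1 - v n].
  elim: n => [|n [v0 vS vM un uS]].
    by rewrite /u /v /= anorm0 !subr0 f0 F0 fM// !lexx.
  have uSn : anorm (u n.+1) <= v n.+1 by have := ler_anorm_dist uS; lra.
  have := Ff _ _ _ _ v0 vS vM uSn un uS; rewrite -!iterS -/(u n.+2) -/(v n.+2).
  move=> uSS; have v0' := le_trans v0 vS; split => //.
    by have := anorm_ge0 (u n.+2 - u n.+1); move: uSS; rewrite /u /v /=; lra.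
  by rewrite /v iterS; exact: fM.
have [l ul] := @majorized_converges u v M (fun n => let: And5 _ _ _ _ e := uv n in e)
  (fun n => let: And5 _ h k _ _ := uv n in le_trans h k).
have uM n : anorm (u n) <= M by have [_ h k /le_trans-> //] := uv n; lra.
have lM := converges_norm ul uM.
exists l; split => //; apply/subr0_eq/anorm_small_eq0 => e e0.
have e1 : 0 < e / (L + 1) by rewrite divr_gt0//; lra.
have [N uN] := ul _ e1.
have := uN _ (leqnSn N); have := uN _ (leqnn N).
rewrite !ler_pdivlMr; [|lra..].
have := FL _ _ lM (uM N); rewrite -[F (u N)]/(u N.+1).
have := ler_anormD (F l - u N.+1) (u N.+1 - l); rewrite addrA subrK (anormB l).
have := anorm_ge0 (u N - l); have := anorm_ge0 (u N.+1 - l).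
by nra.
Qed.

Lemma comm_iter b (F : A -> A) n :
  (forall x, GRing.comm b x -> GRing.comm b (F x)) -> GRing.comm b (iter n F 0).
Proof. by move=> bF; elim: n => [|n /bF//]; exact: commr0. Qed.

Lemma commrZ b (k : R[i]) a : GRing.comm b a -> GRing.comm b (k *: a).
Proof. by rewrite /GRing.comm -scalerAl -scalerAr => ->. Qed.

(** The fixed point of x |-> 1 + z x is the sum of the geometric series in z. *)
Lemma neumann z t : anorm z <= t -> t < 1 -> exists v : A, [/\ (1 - z) * v = 1,
  selfadjoint z -> selfadjoint v & forall b, GRing.comm b z -> GRing.comm b v].
Proof.
move=> zt t1; have t0 : 0 <= t := le_trans (anorm_ge0 z) zt.
have u0 : 0 < 1 - t by lra.
have [|||||x y s r r0 rs sM xs yr xy|x y _ _|v [vE _ vl]] :=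
  @majorant_fixpoint (fun x => 1 + z * x) (fun s : R => 1 + t * s) (1 - t)^-1 1.
- by rewrite invr_ge0 ltW.
- by [].
- by lra.
- by rewrite !mulr0 !addr0 anorm1.
- move=> s _ sM; have ME : (1 - t)^-1 * (1 - t) = 1 by rewrite mulVf// gt_eqF.
  by have := ler_wpM2l t0 sM; lra.
- rewrite opprD addrACA subrr add0r -mulrBr.
  apply: (le_trans (ler_anormM _ _)); have := anorm_ge0 (x - y).
  by have := anorm_ge0 z; nra.
- rewrite opprD addrACA subrr add0r -mulrBr.
  apply: (le_trans (ler_anormM _ _)); have := anorm_ge0 (x - y); nra.
have vcomm b : GRing.comm b z -> GRing.comm b v.
  move=> bz; apply: converges_comm vl _ => n; apply: comm_iter => x bx.
  by apply: commrD; [exact: commr1 | exact: commrM].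
exists v; split => // [|sz].
  by rewrite mulrBl mul1r -{1}vE addrK.
apply: converges_selfadjoint vl _ => n.
suff: GRing.comm z (iter n (fun x => 1 + z * x) 0) /\
      selfadjoint (iter n (fun x => 1 + z * x) 0) by case.
elim: n => [|n [zc sn]]; first by split; [exact: commr0 | exact: star0].
split; first by apply: commrD; [exact: commr1 | exact: commrM].
by rewrite /selfadjoint /= starD star1 starM sz sn zc.
Qed.

(** The binomial series of sqrt (1 - z) converges for every z of norm at most 1,
    the boundary case included: 1 - w is a root of 1 - z exactly when
    w = (z + w w) / 2, and the majorant s |-> (1 + s s) / 2 of this map sends
    [0, 1] to itself. *)
Lemma sqrt_near1 z : selfadjoint z -> anorm z <= 1 ->
  exists w : A, [/\ selfadjoint w, anorm w <= 1, (1 - w) * (1 - w) = 1 - z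
    & forall b, GRing.comm b z -> GRing.comm b w].
Proof.
move=> sz z1.
pose F x := (2^-1)%:C *: (z + x * x).
have FB x y : F x - F y = (2^-1)%:C *: (x * (x - y) + (x - y) * y).
  rewrite /F -scalerBr; congr (_ *: _).
  by rewrite mulrBr mulrBl addrA subrK opprD addrACA subrr add0r.
have half : `|2^-1 : R| = 2^-1 by rewrite ger0_norm// invr_ge0.
have FN x y : anorm (F x - F y) <= 2^-1 * ((anorm x + anorm y) * anorm (x - y)).
  rewrite FB anormZr half ler_pM2l ?invr_gt0//.
  apply: (le_trans (ler_anormD _ _)); have := ler_anormM x (x - y).
  by have := ler_anormM (x - y) y; lra.
have [|||||x y s r r0 rs sM xs yr xy|x y x1 y1|w [wE w1 wl]] :=
  @majorant_fixpoint F (fun s : R => 2^-1 * (1 + s * s)) 1 1.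
- by [].
- by [].
- by lra.
- by rewrite /F anormZr half !mulr0 !addr0; lra.
- by move=> s; nra.
- by have := FN x y; have := anorm_ge0 (x - y); nra.
- by have := FN x y; have := anorm_ge0 (x - y); nra.
exists w; split => // [||b bz].
- apply: converges_selfadjoint wl _; elim=> [|n sn]; first exact: star0.
  by rewrite /selfadjoint iterS starZr starD starM sz sn.
- rewrite mulrBl mul1r mulrBr mulr1 opprB addrA.
  have -> : w * w = w + w - z.
    rewrite -{3 4}wE -scalerDl -rmorphD /= -mulr2n -(mulr_natr (2^-1)).
    by rewrite mulVf ?pnatr_eq0// scale1r addrAC subrr add0r.
  by rewrite !addrA subrK addrAC addrK.
- apply: converges_comm wl _ => n; apply: comm_iter => x bx.
  by apply: commrZ; apply: commrD => //; exact: commrM.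
Qed.

(** * The cone of squares of self-adjoint elements *)

(** Squares of self-adjoint elements stand in for the elements with nonnegative
    spectrum.  That they coincide with the elements of the form star x * x is
    the lemma sasquare_star_mul. *)
Definition sasquare h := exists2 r, selfadjoint r & h = r * r.

Lemma selfadjointD a b : selfadjoint a -> selfadjoint b -> selfadjoint (a + b).
Proof. by rewrite /selfadjoint starD => -> ->. Qed.

Lemma selfadjointN a : selfadjoint a -> selfadjoint (- a).
Proof. by rewrite /selfadjoint starN => ->. Qed.

Lemma selfadjointB a b : selfadjoint a -> selfadjoint b -> selfadjoint (a - b).
Proof. by move=> sa sb; apply/selfadjointD/selfadjointN. Qed.

Lemma selfadjointZ t a : selfadjoint a -> selfadjoint (t%:C *: a).
Proof. by rewrite /selfadjoint starZr => ->. Qed.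

Lemma selfadjoint_scalar t : selfadjoint (t%:C%:A : A).
Proof. exact/selfadjointZ/star1. Qed.

Lemma selfadjointM a b : selfadjoint a -> selfadjoint b -> GRing.comm a b ->
  selfadjoint (a * b).
Proof. by rewrite /selfadjoint starM => -> -> ->. Qed.

Lemma selfadjoint_sqr a : selfadjoint a -> selfadjoint (a * a).
Proof. by move=> sa; exact: selfadjointM. Qed.

Lemma sasquare_sa h : sasquare h -> selfadjoint h.
Proof. by case=> r sr ->; exact: selfadjoint_sqr. Qed.

Lemma sqrtZ t h r : 0 <= t -> r * r = h ->
  ((Num.sqrt t)%:C *: r) * ((Num.sqrt t)%:C *: r) = t%:C *: h.
Proof.
by move=> t0 <-; rewrite -scalerAl -scalerAr scalerA -rmorphM -expr2 sqr_sqrtr.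
Qed.

Lemma sasquareZ t h : 0 <= t -> sasquare h -> sasquare (t%:C *: h).
Proof.
move=> t0 [r sr ->]; exists ((Num.sqrt t)%:C *: r); first exact: selfadjointZ.
by rewrite (sqrtZ t0 erefl).
Qed.

Lemma sasquare_scalar t : 0 <= t -> sasquare (t%:C%:A : A).
Proof. by move=> t0; apply: sasquareZ => //; exists 1; [exact: star1|rewrite mulr1]. Qed.

(** The condition says that the spectrum of h lies in [0, 2 t], without
    mentioning spectra: rescale to t = 1 and apply sqrt_near1 to z = 1 - h.
    The root t^(1/2) (1 - w) is itself a square because w also has norm at most
    1.  It is a limit of polynomials in h, hence commutes with whatever
    commutes with h. *)
Lemma sqrt_exists h t : selfadjoint h -> anorm (t%:C%:A - h) <= t ->
  exists r, [/\ selfadjoint r, sasquare r, r * r = h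
    & forall b, GRing.comm b h -> GRing.comm b r].
Proof.
move=> sh ht; have t0 : 0 <= t := le_trans (anorm_ge0 _) ht.
have [t00|t_neq0] := eqVneq t 0.
  exists 0; have -> : h = 0.
    apply/anorm0_eq0/eqP; rewrite eq_le anorm_ge0 andbT.
    by move: ht; rewrite t00 scale0r sub0r anormN.
  split; [exact: star0 | by exists 0; [exact: star0 | rewrite mulr0]
    | by rewrite mulr0 | by move=> b _; exact: commr0].
pose z := 1 - t^-1%:C *: h.
have zE : t%:C *: (1 - z) = h.
  by rewrite /z opprB addrC subrK scalerA -rmorphM mulfV// scale1r.
have sz : selfadjoint z.
  by apply: selfadjointB; [exact: star1 | exact: selfadjointZ].
have z1 : anorm z <= 1.
  have tp : 0 < t by rewrite lt_def t_neq0.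
  rewrite -(ler_pM2l tp) mulr1 -{1}(ger0_norm t0) -anormZr.
  by rewrite /z scalerBr scalerA -rmorphM mulfV// scale1r.
have [w [sw w1 wz wb]] := sqrt_near1 sz z1.
have [w' [sw' _ ww _]] := sqrt_near1 sw w1.
exists ((Num.sqrt t)%:C *: (1 - w)); split.
- by apply/selfadjointZ/selfadjointB => //; exact: star1.
- apply: sasquareZ; first exact: sqrtr_ge0.
  by exists (1 - w') => //; apply/selfadjointB => //; exact: star1.
- by rewrite (sqrtZ t0 wz).
move=> b bh; apply/commrZ/commrB; first exact: commr1.
by apply/wb/commrB; [exact: commr1 | exact: commrZ].
Qed.

Lemma half_double a : (2^-1 : R)%:C *: (a + a) = a.
Proof.
rewrite scalerDr -scalerDl -rmorphD (_ : 2^-1 + 2^-1 = 1) ?scale1r//.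
by lra.
Qed.

(** The element u = c + i g satisfies star u * u = t, which gives its norm, and
    c is the real part of u. *)
Lemma sum_squares_norm (c g : A) t : selfadjoint c -> selfadjoint g -> GRing.comm c g ->
  c * c + g * g = t%:C%:A -> anorm c ^+ 2 <= `|t|.
Proof.
move=> sc sg cg cgt; pose u := c + 'i%C *: g.
have su : star u = c - 'i%C *: g by rewrite starD starZi sc sg scaleNr.
have uu : star u * u = t%:C%:A.
  rewrite su -cgt mulrBl !mulrDr -!scalerAl -!scalerAr -cg scalerA.
  by rewrite -(expr2 'i%C) sqr_i scaleN1r opprB [_ - _ *: _]addrC addrA addrK.
rewrite -(anorm_scalar t) -uu anorm_starM.
have : anorm c <= anorm u.
  rewrite -[c in leLHS]half_double anormZr ger0_norm ?invr_ge0//.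
  have -> : c + c = u + star u by rewrite su addrACA subrr addr0.
  by have := ler_anormD u (star u); rewrite anorm_star; lra.
by rewrite !expr2; have := anorm_ge0 c; nra.
Qed.

(** Converse of sqrt_exists.  Let g be the root of t - r r, which exists because
    the norm of r r is at most t; then r r + g g = t bounds the norm of g, and
    g g is the element to be estimated. *)
Lemma sqr_dist_le r t : selfadjoint r -> anorm (r * r) <= t ->
  anorm (t%:C%:A - r * r) <= t.
Proof.
move=> sr rt; have t0 : 0 <= t := le_trans (anorm_ge0 _) rt.
have sh : selfadjoint (t%:C%:A - r * r).
  by apply: selfadjointB; [exact: selfadjoint_scalar | exact: selfadjoint_sqr].
have [|g [sg _ gE gb]] := sqrt_exists sh (t := t); first by rewrite subKr.
rewrite -gE anorm_sqr// -[leRHS]ger0_norm//; apply: (@sum_squares_norm _ r) => //.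
  apply/commr_sym/gb/commrB; last exact: commrM.
  by apply: commrZ; exact: commr1.
by rewrite gE subrK.
Qed.

Lemma sasquare_dist h t : sasquare h -> anorm h <= t -> anorm (t%:C%:A - h) <= t.
Proof. by case=> r sr ->; exact: sqr_dist_le. Qed.

Lemma sasquare_sqrt h : sasquare h ->
  exists r, [/\ selfadjoint r, sasquare r, r * r = h
    & forall b, GRing.comm b h -> GRing.comm b r].
Proof.
move=> sh; apply: (@sqrt_exists _ (anorm h)); first exact: sasquare_sa.
exact: sasquare_dist.
Qed.

Lemma sasquare_of_dist h t : selfadjoint h -> anorm (t%:C%:A - h) <= t -> sasquare h.
Proof. by move=> sh /(sqrt_exists sh)[r [sr _ <- _]]; exists r. Qed.

(** Immediate from the norm characterization of squares, by the triangle
    inequality; the same characterization makes the squares a closed set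
    (sasquare_closed). *)
Lemma sasquareD h k : sasquare h -> sasquare k -> sasquare (h + k).
Proof.
move=> ph pk; apply: (@sasquare_of_dist _ (anorm h + anorm k)).
  by apply: selfadjointD; exact: sasquare_sa.
rewrite rmorphD scalerDl opprD addrACA (le_trans (ler_anormD _ _))//.
by apply: lerD; exact: sasquare_dist.
Qed.

Lemma sasquareM h k : sasquare h -> sasquare k -> GRing.comm h k -> sasquare (h * k).
Proof.
move=> /sasquare_sqrt[r [sr _ <- rb]] /sasquare_sqrt[s [ss _ <- sb]] hk.
have rs : GRing.comm r s by apply: sb; apply/commr_sym/rb/commr_sym.
exists (r * s); first exact: selfadjointM.
by rewrite -!mulrA; congr (_ * _); rewrite !mulrA rs.
Qed.

Lemma sasquare_closed h : selfadjoint h ->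
    (forall e : R, 0 < e -> exists2 k, sasquare k & anorm (h - k) <= e) ->
  sasquare h.
Proof.
move=> sh near; apply: (@sasquare_of_dist _ (anorm h + 1)) => //.
apply/ler_addgt0Pr => e e0.
have [|k pk hk] := near (Num.min e 1); first by rewrite lt_min e0 ltr01.
have [hke hk1] : anorm (h - k) <= e /\ anorm (h - k) <= 1.
  by move: hk; rewrite le_min => /andP.
have kt : anorm k <= anorm h + 1 by rewrite anormB in hk1; exact: ler_anorm_dist.
have := ler_anormD ((anorm h + 1)%:C%:A - k) (k - h); rewrite addrA subrK.
by have := sasquare_dist pk kt; rewrite (anormB k); lra.
Qed.

Lemma sasquare_le_norm h : selfadjoint h -> sasquare ((anorm h)%:C%:A - h).
Proof.
move=> sh; apply: (@sasquare_of_dist _ (anorm h)); last by rewrite subKr.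
by apply: selfadjointB; [exact: selfadjoint_scalar|].
Qed.

Lemma sasquare_antisym h : sasquare h -> sasquare (- h) -> h = 0.
Proof.
move=> ph pNh; apply: anorm0_eq0; apply/eqP; rewrite eq_le anorm_ge0 andbT.
have [r [sr _ hr rb]] := sasquare_sqrt ph.
have [s [ss _ hs sb]] := sasquare_sqrt pNh.
have := @sum_squares_norm r s 0 sr ss; rewrite normr0 hr hs subrr scale0r.
rewrite -hr anorm_sqr//; apply => //.
by apply: sb; rewrite -hr; apply: commrN; exact: commrM.
Qed.

(** * Positivity of star y * y *)

(** After rescaling, t + p is 1 - z with z of norm at most |p| / (t + |p|) < 1. *)
Lemma sasquare_inverse p t : sasquare p -> 0 < t ->
  exists v, [/\ (t%:C%:A + p) * v = 1, selfadjoint v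
    & forall b, GRing.comm b p -> GRing.comm b v].
Proof.
move=> pp t0; pose c := t + anorm p; have p0 := anorm_ge0 p.
have c0 : 0 < c by rewrite /c; lra.
pose z := c^-1%:C *: ((anorm p)%:C%:A - p).
have cz : c%:C *: (1 - z) = t%:C%:A + p.
  rewrite /z scalerBr scalerA -rmorphM mulfV ?gt_eqF// scale1r /c.
  by rewrite rmorphD scalerDl opprB [p - _]addrC addrA addrK.
have zc : anorm z <= c^-1 * anorm p.
  rewrite /z anormZr ger0_norm ?invr_ge0 ?(ltW c0)// ler_pM2l ?invr_gt0//.
  exact: sasquare_dist.
have [|v [zv sv vb]] := neumann zc.
  by rewrite mulrC ltr_pdivrMr// /c; lra.
exists (c^-1%:C *: v); split.
- by rewrite -cz -scalerAr -scalerAl scalerA -rmorphM mulVf ?gt_eqF// scale1r.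
- apply/selfadjointZ/sv/selfadjointZ/selfadjointB; last exact: sasquare_sa.
  exact: selfadjoint_scalar.
move=> b bp; apply/commrZ/vb/commrZ/commrB => //.
by apply: commrZ; exact: commr1.
Qed.

(** The norm of a to the fourth power is the fourth power of the norm of a. *)
Lemma cube_eq0 a : selfadjoint a -> a * a * a = 0 -> a = 0.
Proof.
move=> sa a3; apply: anorm0_eq0; apply/eqP.
rewrite -sqrf_eq0 -anorm_sqr// -sqrf_eq0.
rewrite -anorm_sqr; last exact: selfadjoint_sqr.
by rewrite mulrA a3 mul0r anorm0.
Qed.

(** The inverse d of s s is the square (d s)(d s), so t - d is a square for
    large t; multiplying by s s turns this into t s s - 1. *)
Lemma invertible_sasquare_bounded s d : selfadjoint s -> s * s * d = 1 ->
  exists2 e : R, 0 < e <= 1 & sasquare (s * s - e%:C%:A).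
Proof.
move=> ss sd.
have [ds sad] : d * (s * s) = 1 /\ selfadjoint d.
  have dE : star d = d.
    rewrite -[LHS]mulr1 -sd mulrA -[star d * _]starK.
    by rewrite starM starK (selfadjoint_sqr ss) sd star1 mul1r.
  by split=> //; rewrite -[LHS]starK starM (selfadjoint_sqr ss) dE sd star1.
have cds : GRing.comm d (s * s) by rewrite /GRing.comm sd ds.
pose t := anorm d + 1; have d0 := anorm_ge0 d; have t0 : 0 < t by rewrite /t; lra.
(* Here t - d = (norm d - d) + 1. *)
have pos : sasquare (t%:C%:A - d).
  rewrite /t rmorphD scalerDl addrAC scale1r; apply: sasquareD.
    exact: sasquare_le_norm.
  by exists 1; [exact: star1 | rewrite mulr1].
exists t^-1.
  by rewrite invr_gt0 t0 invf_le1// /t; lra.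
have -> : s * s - t^-1%:C%:A = t^-1%:C *: ((t%:C%:A - d) * (s * s)).
  rewrite mulrBl ds scalerBr -scalerAl mul1r scalerA -rmorphM.
  by rewrite mulVf ?gt_eqF// scale1r.
apply: sasquareZ; first by rewrite invr_ge0 (ltW t0).
apply: sasquareM => //; first by exists s.
apply/commr_sym/commrB; last exact/commr_sym.
by apply: commrZ; exact: commr1.
Qed.

(** The spectrum of c c contains its norm: if 1 - c c were invertible it would
    be bounded below by some e > 0, so c c would have norm at most 1 - e. *)
Lemma one_sub_sqr_not_invertible c d : selfadjoint c -> anorm c = 1 ->
  (1 - c * c) * d = 1 -> False.
Proof.
move=> sc c1.
have scc : selfadjoint (1 - c * c).
  by apply: selfadjointB; [exact: star1 | exact: selfadjoint_sqr].
have [|s [ss _ sE _]] := @sqrt_exists (1 - c * c) 1 scc.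
  by rewrite scale1r subKr anorm_sqr// c1 expr1n.
rewrite -sE => /(invertible_sasquare_bounded ss)[e /andP[e0 e1]].
rewrite sE => /sasquare_sqrt[g [sg _ gE gb]].
have := @sum_squares_norm c g (1 - e) sc sg.
rewrite gE c1 expr1n ger0_norm; last by lra.
suff cg : GRing.comm c g.
  move=> /(_ cg); rewrite rmorphB scalerBl scale1r addrA [c * c + _]addrC subrK.
  by move=> /(_ erefl); lra.
apply: gb; apply: commrB; last by apply: commrZ; exact: commr1.
by apply: commrB; [exact: commr1 | exact: commrM].
Qed.

(** With k = u + i v, the sum is 2 (u u + v v). *)
Lemma sasquare_star_comm k : sasquare (k * star k + star k * k).
Proof.
pose a := k + star k; pose b := 'i%C *: (k - star k).
have sa : selfadjoint a by rewrite /selfadjoint starD starK addrC.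
have sb : selfadjoint b.
  by rewrite /selfadjoint starZi starB starK scaleNr -scalerN opprB.
have -> : k * star k + star k * k = (2^-1)%:C *: (a * a + b * b).
  rewrite -[LHS]half_double; congr (_ *: _).
  rewrite /b -scalerAl -scalerAr scalerA -(expr2 'i%C) sqr_i scaleN1r /a.
  rewrite !mulrBl !mulrBr !mulrDl !mulrDr !opprB.
  set p := k * k; set q := k * star k; set r := star k * k; set s := star k * star k.
  rewrite [r - s + _]addrC [RHS]addrACA [p + q]addrC [q + p + _]addrACA.
  by rewrite [r + s + _]addrACA !subrr !addr0 addrACA.
apply: sasquareZ; first by rewrite invr_ge0.
by apply: sasquareD; [exists a | exists b].
Qed.

(** Since star k * k = - c c, the previous lemma makes k (star k) a
    square, so 1 + k (star k) is invertible.  Products taken in the two orders have the same nonzero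
    spectrum; here, 1 - star k v k inverts 1 + star k * k = 1 - c c, where
    v is the inverse of 1 + k (star k).  For c of norm 1 this is impossible. *)
Lemma neg_star_mul_eq0 k c : selfadjoint c -> star k * k = - (c * c) -> c = 0.
Proof.
move=> sc; wlog c1 : k c sc / anorm c = 1 => [hw kE|kE].
  apply/eqP/negPn/negP => /eqP /anorm_gt0 c0.
  have l1 : anorm ((anorm c)^-1%:C *: c) = 1.
    by rewrite anormZr ger0_norm ?invr_ge0 ?(ltW c0)// mulVf ?gt_eqF.
  have := hw ((anorm c)^-1%:C *: k) _ (selfadjointZ _ sc) l1.
  rewrite starZr -!scalerAl -!scalerAr kE !scalerN => /(_ erefl) c'0.
  by move: l1; rewrite c'0 anorm0 => /esym/eqP; rewrite oner_eq0.
have pos : sasquare (k * star k).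
  rewrite -[_ * _](addrK (star k * k)) {2}kE opprK.
  by apply: sasquareD; [exact: sasquare_star_comm | exists c].
(* The case t = 1: v inverts 1 + k (star k). *)
have [v [vE _ _]] := sasquare_inverse pos (@ltr01 R).
rewrite scale1r in vE.
case: (@one_sub_sqr_not_invertible c (1 - star k * v * k) sc c1).
rewrite -kE mulrBr mulr1 mulrDl mul1r.
have -> : star k * v * k + star k * k * (star k * v * k)
    = star k * ((1 + k * star k) * v) * k.
  by rewrite mulrDl mul1r mulrDr mulrDl !mulrA.
by rewrite vE mulr1 addrK.
Qed.

(** Let m be the modulus of T = star y * y and N = m - T, which is twice the
    negative part of T.  Then T N = - m N, so k = y N satisfies
    star k * k = - m N N, where m N N is a square as a product of commuting
    squares.  Hence m N N = 0, which forces N = 0 and T = m. *)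
Lemma sasquare_star_mul y : sasquare (star y * y).
Proof.
pose T := star y * y; rewrite -/T.
have sT : selfadjoint T by rewrite /selfadjoint starM starK.
have [|m [sm pm mm mb]] := @sasquare_sqrt (T * T); first by exists T.
have Tm : GRing.comm T m by apply: mb; exact: commrM.
pose N := m - T; have sN : selfadjoint N by exact: selfadjointB.
have TN : T * N = - (m * N) by rewrite !mulrBr mm Tm opprB.
have NT : GRing.comm N T by apply/commr_sym/commrB.
have Nm : GRing.comm N m by apply/commr_sym/commrB => //; exact/commr_sym.
have [|c [sc _ cE _]] := @sasquare_sqrt (m * (N * N)).
  by apply: sasquareM => //; [exists N | apply: commrM; exact: commr_sym].
have c0 : c = 0.
  apply: (@neg_star_mul_eq0 (y * N)) => //.
  rewrite cE starM sN -mulrA (mulrA (star y)) -/T TN mulrN; congr (- _).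
  by rewrite !mulrA Nm.
have mNN : m * N * N = 0 by rewrite -mulrA -cE c0 mul0r.
have : N = 0.
  apply: cube_eq0 => //; rewrite -mulrA {3}/N mulrBr NT TN Nm opprK mulrDr.
  by rewrite mulrA Nm mNN addr0.
by move=> /subr0_eq <-.
Qed.

(** * Orthogonal elements in corners *)

(** For N = m - h the relations h N = - m N and m m = h h make the cube of N a
    multiple of m m N = h N h. *)
Lemma modulus_sign h m : selfadjoint h -> selfadjoint m -> GRing.comm h m ->
  m * m = h * h -> h * (m - h) * h = 0 -> h = m.
Proof.
move=> sh sm hm mm z; pose N := m - h.
have hN : h * N = - (m * N) by rewrite !mulrBr mm hm opprB.
have ch : GRing.comm h N by exact: commrB.
have mmN : m * m * N = 0 by rewrite mm -mulrA ch mulrA.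
have NN : N * N = (2 : R)%:C *: (m * N).
  rewrite {1}/N mulrBl hN opprK (rmorphD (real_complex R) 1 1).
  by rewrite scalerDl scale1r.
suff /subr0_eq-> : N = 0 by [].
apply: cube_eq0; first exact: selfadjointB.
rewrite NN -scalerAl -mulrA NN -scalerAr mulrA mmN.
by rewrite !scaler0.
Qed.

(** Divide k - t p by t and let t tend to infinity: - p is a limit of squares. *)
Lemma dominates_all_multiples_eq0 p k : sasquare p ->
  (forall t : R, sasquare (k - t%:C *: p)) -> p = 0.
Proof.
move=> pp dom; apply: sasquare_antisym => //.
apply: sasquare_closed => [|e e0]; first exact/selfadjointN/sasquare_sa.
have k0 : 0 < anorm k + 1 by have := anorm_ge0 k; lra.
(* For this t the norm of k / t is at most e. *)
pose t := (anorm k + 1) / e; have t0 : 0 < t by exact: divr_gt0.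
exists (t^-1%:C *: (k - t%:C *: p)).
  by apply: sasquareZ; rewrite ?invr_ge0 ?(ltW t0).
rewrite scalerBr scalerA -rmorphM mulVf ?gt_eqF// scale1r opprB addrA addNr add0r.
rewrite anormN anormZr ger0_norm ?invr_ge0 ?(ltW t0)// mulrC ler_pdivrMr//.
by rewrite /t mulrC divfK ?gt_eqF//; lra.
Qed.

(** A Dedekind cut: the t with k <= t p form a half-line whose infimum v
    satisfies both k <= v p and v p <= k, because the squares are closed. *)
Lemma proportional_of_sign k p : selfadjoint k -> sasquare p -> p <> 0 ->
    (forall t : R, sasquare (k - t%:C *: p) \/ sasquare (- (k - t%:C *: p))) ->
  exists t : R, k = t%:C *: p.
Proof.
move=> sk pp p0 sign; have np := anorm_ge0 p.
pose E := [set t : R | sasquare (- (k - t%:C *: p))]%classic.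
have [t Et] : exists t, E t.
  apply: contrapT => nE; apply: p0; apply: (@dominates_all_multiples_eq0 p k) => // t.
  by case: (sign t) => // Et; case: nE; exists t.
have [u ku] : exists u : R, sasquare (k - u%:C *: p).
  apply: contrapT => nE; apply: p0; apply: (@dominates_all_multiples_eq0 p (- k)) => // u.
  case: (sign (- u)) => [ku|]; first by case: nE; exists (- u).
  by rewrite opprB rmorphN scaleNr addrC.
have lbE : lbound E u.
  move=> s Es; rewrite leNgt; apply/negP => su; apply: p0.
  have pos : sasquare ((u - s)%:C *: p) by apply: sasquareZ => //; lra.
  have neg : sasquare (- ((u - s)%:C *: p)).
    rewrite rmorphB scalerBl opprB -(subrK k (s%:C *: p)) -addrA.
    by apply: sasquareD => //; rewrite -opprB.
  have /eqP := sasquare_antisym pos neg; rewrite scaler_eq0 => /orP[|/eqP//].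
  by rewrite eq_complex /= subr_eq0 gt_eqF.
have hE : has_inf E by split; [exists t | exists u].
pose v := inf E; exists v; apply/subr0_eq.
have d0 (e : R) : 0 < e -> 0 < e / (anorm p + 1) by move=> e0; rewrite divr_gt0//; lra.
have sv (s : R) : selfadjoint (k - s%:C *: p).
  by apply: selfadjointB => //; exact/selfadjointZ/sasquare_sa.
have dist (s e : R) : 0 < e -> `|v - s| <= e / (anorm p + 1) ->
    anorm ((k - v%:C *: p) - (k - s%:C *: p)) <= e.
  move=> e0; rewrite ler_pdivlMr; last by lra.
  move=> vs; rewrite opprB addrC addrA subrK -scalerBl -rmorphB anormZr distrC.
  by have := normr_ge0 (v - s); nra.
apply: sasquare_antisym; apply: sasquare_closed.
- exact: sv.
- move=> e e0.
  exists (k - (v - e / (anorm p + 1))%:C *: p); last first.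
    by apply: dist => //; rewrite subKr ger0_norm// ltW// d0.
  case: (sign (v - e / (anorm p + 1))) => // Es.
  have : v <= v - e / (anorm p + 1) by apply: ge_inf => //; case: hE.
  by have := d0 _ e0; lra.
- exact/selfadjointN/sv.
- move=> e e0; have [s Es sv'] := inf_adherent (d0 _ e0) hE.
  exists (- (k - s%:C *: p)) => //; rewrite -opprD anormN; apply: dist => //.
  have : v <= s by apply: ge_inf => //; case: hE.
  by move=> vs; rewrite distrC ger0_norm; lra.
Qed.

(** No closure is taken: all elements constructed below lie in r A r itself. *)
Definition in_corner r h := exists x, h = r * x * r.

Lemma in_corner_trans r s h : in_corner r s -> in_corner s h -> in_corner r h.
Proof. by case=> x -> [y ->]; exists (x * r * y * r * x); rewrite !mulrA. Qed.

(** In terms of spectra: no self-adjoint element of the hereditary subalgebra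
    generated by r has two nonzero spectral values. *)
Definition nonsplitting r := forall s t : A, selfadjoint s -> selfadjoint t ->
  in_corner r s -> in_corner r t -> s * t = 0 -> s = 0 \/ t = 0.

Lemma selfadjoint_conj h a : selfadjoint h -> selfadjoint a -> selfadjoint (h * a * h).
Proof. by rewrite /selfadjoint !starM mulrA => -> ->. Qed.

(** The elements h (m + h) h and h (m - h) h, with m the modulus of h, are
    up to a factor the cubes of the positive and negative parts of h.  They are
    orthogonal, and the outer factors h place them in the corner of r. *)
Lemma nonsplitting_sign r h : nonsplitting r -> selfadjoint h -> in_corner r h ->
  sasquare h \/ sasquare (- h).
Proof.
move=> nr sh rh; have [|m [sm pm mm mb]] := @sasquare_sqrt (h * h); first by exists h.
have hm : GRing.comm h m by apply: mb; exact: commrM.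
have corner_h x : in_corner r (h * x * h) by apply: (in_corner_trans rh); exists x.
have st0 : h * (m + h) * h * (h * (m - h) * h) = 0.
  have ch : GRing.comm h (m + h) by exact: commrD.
  have cb : GRing.comm h (m - h) by exact: commrB.
  rewrite cb -(mulrA h _ h) -ch !mulrA -(mulrA _ (m + h)).
  by rewrite mulrDl !mulrBr mm hm addrA subrK subrr mulr0 !mul0r.
have [s0|t0] := nr _ _ (selfadjoint_conj sh (selfadjointD sm sh))
  (selfadjoint_conj sh (selfadjointB sm sh)) (corner_h _) (corner_h _) st0.
- right; rewrite (@modulus_sign (- h) m) ?mulrNN//; first exact: selfadjointN.
    exact/commr_sym/commrN/commr_sym.
  by rewrite opprK mulrN !mulNr opprK.
- by left; rewrite (@modulus_sign h m).
Qed.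

(** Every r r (r r - t) lies in the corner of r, so it has a sign; hence
    r r r r is a multiple l (r r), and r r / l is a projection. *)
Lemma nonsplitting_projection r : selfadjoint r -> r <> 0 -> nonsplitting r ->
  exists p, [/\ projection p, p <> 0 & in_corner r p].
Proof.
move=> sr r0 nr; have srr := selfadjoint_sqr sr.
have rr0 : r * r <> 0.
  by move=> rr0; apply: r0; apply: cube_eq0; rewrite ?rr0 ?mul0r.
have [||||l lE] := @proportional_of_sign (r * r * (r * r)) (r * r) => //.
- exact: selfadjoint_sqr.
- by exists r.
- move=> t; apply: nonsplitting_sign nr _ _.
    by apply: selfadjointB (selfadjoint_sqr srr) (selfadjointZ _ srr).
  exists (r * r - t%:C%:A).
  by rewrite mulrBr mulrBl -scalerAr mulr1 -scalerAl !mulrA.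
have l0 : l != 0.
  apply/eqP => l0; apply: rr0; apply: cube_eq0 => //.
  by rewrite lE l0 scale0r mul0r.
exists (l^-1%:C *: (r * r)); split.
- split; first exact: selfadjointZ.
  rewrite -scalerAl -scalerAr lE; congr (_ *: _).
  by rewrite scalerA -rmorphM mulVf// scale1r.
- move/eqP; rewrite scaler_eq0 => /orP[|/eqP//].
  by rewrite eq_complex /= invr_eq0 (negPf l0).
- by exists (l^-1%:C%:A); rewrite -scalerAr mulr1 -scalerAl.
Qed.

(** For self-adjoint y each p y p - t p lies in the corner of r and so has a
    sign; hence p y p is a multiple of p.  A general x is decomposed into real
    and imaginary parts. *)
Lemma nonsplitting_corner r p : nonsplitting r -> projection p -> p <> 0 ->
  in_corner r p -> forall x, exists k : R[i], p * x * p = k *: p.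
Proof.
move=> nr [sp pp] p0 rp x.
have real y : selfadjoint y -> exists t : R, p * y * p = t%:C *: p.
  move=> sy; apply: proportional_of_sign => //; first exact: selfadjoint_conj.
    by exists p.
  move=> t; apply: nonsplitting_sign nr _ _.
    by apply: selfadjointB (selfadjoint_conj _ _) (selfadjointZ _ _).
  apply: (in_corner_trans rp); exists (y - t%:C%:A).
  by rewrite mulrBr mulrBl -scalerAr mulr1 -scalerAl pp.
have [|t tE] := real (x + star x); first by rewrite /selfadjoint starD starK addrC.
have [|u uE] := real ('i%C *: (x - star x)).
  by rewrite /selfadjoint starZi starB starK scaleNr -scalerN opprB.
(* x is half of (x + star x) - i (i (x - star x)). *)
exists ((2^-1)%:C * (t%:C - 'i%C * u%:C)).
rewrite -scalerA scalerBl -tE -[in X in _ - X]scalerA -uE.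
rewrite -scalerAr -scalerAl scalerA -(expr2 'i%C) sqr_i scaleN1r opprK.
rewrite -mulrDl -mulrDr addrACA subrr addr0.
by rewrite mulrDr mulrDl half_double.
Qed.

Lemma cspan_approx (X : set (nspace A)) (v : A) (e : R) : cspan X v -> 0 < e ->
  exists2 w : A, lspan X w & anorm (v - w) <= e.
Proof.
move=> Xv e0; have eC : 0 < e%:C :> R[i] by rewrite ltcR.
have [w [Xw]] := Xv _ (nbhsx_ballx (v : nspace A) _ eC).
by rewrite -ball_normE /= ltcR => /ltW vw; exists w.
Qed.

Lemma one_dimensional_corner p : projection p ->
  (forall x, exists k : R[i], p * x * p = k *: p) ->
  ~ infinite_dimensional (corner p).
Proof.
move=> [sp pp] line; apply; exists 1%N, (fun=> p).
apply/seteqP; split => v.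
  move=> vp; suff vE : v = p * v * p.
    have [k vk] := line v; exists 1%N, (fun=> k), (fun=> p).
    by split; [move=> i; exists ord0 | rewrite big_ord1 -vk].
  apply/subr0_eq/anorm_small_eq0 => e e0; pose q := anorm p.
  have q0 : 0 <= q := anorm_ge0 p.
  have d0 : 0 < 1 + q * q by nra.
  have [w [n [c [x [xp wE]]]]] := cspan_approx vp (divr_gt0 e0 d0).
  have wpp : w = p * w * p.
    rewrite wE mulr_sumr mulr_suml; apply: eq_bigr => i _.
    have [y _ <-] := xp i.
    by rewrite -scalerAr -scalerAl !mulrA pp -!mulrA pp.
  rewrite ler_pdivlMr// => vw.
  rewrite (_ : v - _ = (v - w) - p * (v - w) * p); last first.
    by rewrite mulrBr mulrBl -wpp opprB addrA subrK.
  have := ler_anormB (v - w) (p * (v - w) * p).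
  have := ler_anormM (p * (v - w)) p; have := ler_anormM p (v - w).
  by rewrite -/q; have := anorm_ge0 (v - w); nra.
case=> n [c [x [xp ->]]]; apply: subset_closure.
exists n, c, x; split => // i; have [_ _ <-] := xp i.
by exists 1 => //; rewrite mulr1.
Qed.

(** Otherwise r is nonsplitting and the corner of some nonzero projection is a
    line. *)
Lemma orthogonal_split r :
    (forall p : A, projection p -> p <> 0 -> infinite_dimensional (corner p)) ->
    selfadjoint r -> r <> 0 ->
  exists s t : A, [/\ selfadjoint s /\ selfadjoint t, s <> 0 /\ t <> 0,
    in_corner r s /\ in_corner r t & s * t = 0].
Proof.
move=> inf sr r0; apply: contrapT => nosplit.
have nr : nonsplitting r.
  move=> s t ss st rs rt st0; apply: contrapT => /not_orP[s0 t0].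
  by apply: nosplit; exists s, t.
have [p [pp p0 rp]] := nonsplitting_projection sr r0 nr.
apply: (one_dimensional_corner pp) (inf p pp p0).
exact: nonsplitting_corner nr pp p0 rp.
Qed.

Lemma orthogonal_family r n :
    (forall p : A, projection p -> p <> 0 -> infinite_dimensional (corner p)) ->
    selfadjoint r -> r <> 0 ->
  exists f : nat -> A,
    (forall i, (i <= n)%N -> [/\ selfadjoint (f i), f i <> 0 & in_corner r (f i)]) /\
    (forall i j, (i <= n)%N -> (j <= n)%N -> i != j -> f i * f j = 0).
Proof.
move=> inf; elim: n r => [|n IH] r sr r0.
  exists (fun=> r * 1 * r); split => [i _|[|i] [|j]//].
  split; last by exists 1.
    by rewrite mulr1; exact: selfadjoint_sqr.
  rewrite mulr1 => rr0; apply: r0; apply: cube_eq0 => //.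
  by rewrite rr0 mul0r.
have [s [t [[ss st] [s0 t0] [rs rt] ts]]] := orthogonal_split inf sr r0.
have ts0 : t * s = 0 by rewrite -[LHS]starK starM ss st ts star0.
have [f [fP forth]] := IH s ss s0.
(* Keep t and split s further. *)
exists (fun i => if i is j.+1 then f j else t); split.
  case=> [|i] //; rewrite ltnS => /fP[sf f0 sfi]; split => //.
  exact: in_corner_trans sfi.
have mix i : (i <= n)%N -> f i * t = 0 /\ t * f i = 0.
  move=> /fP[_ _ [x ->]]; split; first by rewrite -mulrA ts mulr0.
  by rewrite !mulrA ts0 !mul0r.
case=> [|i] [|j] //; rewrite ?ltnS => ni nj ij; last exact: forth.
  by case: (mix j nj).
by case: (mix i ni).
Qed.

End CstarAlgebra.

(** * Minimality and strict infiniteness *)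

Section Filling.
Variables (R : realType) (A : cstarAlgType R).

(** The sum of t and a square is invertible with a self-adjoint inverse v; if q
    is the square root of S then w = v q. *)
Lemma inverse_sqrt (S : A) (t : R) : 0 < t -> positive (S - t%:C%:A) ->
  exists2 w, selfadjoint w & w * S * w = 1.
Proof.
move=> t0 [y yE]; set p := S - _ in yE.
have pp : sasquare p by rewrite yE; exact: sasquare_star_mul.
have SE : t%:C%:A + p = S by rewrite addrC subrK.
have [v [vE sv vb]] := sasquare_inverse pp t0; rewrite SE in vE.
have [|q [sq _ qE qb]] := @sasquare_sqrt _ _ S.
  by rewrite -SE; apply: sasquareD => //; apply: sasquare_scalar; exact: ltW.
have cp b : GRing.comm b S -> GRing.comm b p.
  move=> bS; apply: commrB => //; apply: commrZ; exact: commr1.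
have vq : GRing.comm v q.
  by apply/commr_sym/vb/cp; rewrite -qE; exact: commrM.
have Sv : GRing.comm S v by apply/vb/cp.
exists (v * q); first exact: selfadjointM.
rewrite -mulrA (mulrA S) vE mul1r -mulrA qE.
by rewrite -Sv.
Qed.

Variables (G : groupType) (alpha : action A G) (n : nat).
Hypothesis alpha_filling : filling alpha n.

(** The translates of the b i add up to at least 1/2, hence to an element with
    an inverse square root. *)
Lemma filling_sqrt (b : 'I_n -> A) :
    (forall i, positive (b i) /\ anorm (b i) = 1) ->
  exists (g : 'I_n -> G) (w : A), selfadjoint w /\
    w * (\sum_(i < n) alpha (g i) (b i)) * w = 1.
Proof.
move=> bP; have [|g /inverse_sqrt[|w sw wE]] := alpha_filling bP (_ : 0 < 2^-1).
- by rewrite invr_gt0.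
- by lra.
by exists g, w.
Qed.

(** If x is in I and nonzero, so are the translates of star x * x, up to scaling
    to norm 1; hence their sum, which can be multiplied to 1. *)
Lemma filling_minimal : minimal alpha.
Proof.
move=> I Il Ir Ia; have [[x [Ix x0]]|none] := pselect (exists x, I x /\ x <> 0).
  right; apply/seteqP; split => // a _.
  have xn : 0 < (anorm x)^-1 by rewrite invr_gt0; exact: anorm_gt0.
  pose y : A := (anorm x)^-1%:C *: x.
  have y1 : anorm (star y * y) = 1.
    rewrite anorm_starM anormZr ger0_norm ?(ltW xn)// mulVf ?expr1n//.
    by apply/eqP => /anorm0_eq0.
  have [|g [w [_ wE]]] := @filling_sqrt (fun=> star y * y).
    by move=> _; split => //; exists y.
  rewrite -[a]mulr1 -wE; apply/Il/Ir/Il.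
  elim/big_ind: _ => [|u v|i _]; [exact: carrier0 | exact: carrierD |].
  apply/Ia/Il; exact: carrierZ.
left; apply/seteqP; split => [x Ix|_ ->]; last exact: carrier0.
by apply: contrapT => x0; apply: none; exists x.
Qed.

Hypothesis corner_infinite : forall p : A,
  projection p -> p <> 0 -> infinite_dimensional (corner p).

(** Take n + 1 pairwise orthogonal self-adjoint f 0, ..., f n in a A a.  The
    square of f 0 is the element left over.  The normalized squares of the
    others have translates with sum S and w S w = 1, so that for
    a = star x * x one gets a = star x w S w x.  Its summand of index i is the
    product star z * z for z of degree g i ^-1 with coefficient
    r i alpha_(g i ^-1) (w x). *)
Lemma filling_strictly_infinite (a : A) : positive a -> a <> 0 ->
  strictly_infinite (B := action_bundle alpha) a.
Proof.
move=> [x ax] a0.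
have sa : selfadjoint a by rewrite /selfadjoint ax starM starK.
have [f [fP forth]] := @orthogonal_family _ _ a n corner_infinite sa a0.
pose r (i : 'I_n) : A := (anorm (f i.+1))^-1%:C *: f i.+1.
have rP (i : 'I_n) : [/\ selfadjoint (r i), anorm (r i) = 1 & in_corner a (r i)].
  have [sf f0 [y fE]] := fP i.+1 (ltn_ord i); have fn := anorm_gt0 f0.
  split; first exact: selfadjointZ.
    by rewrite anormZr ger0_norm ?invr_ge0 ?(ltW fn)// mulVf ?gt_eqF.
  by exists ((anorm (f i.+1))^-1%:C *: y); rewrite -scalerAr -scalerAl -fE.
have [|g [w [sw wE]]] := @filling_sqrt (fun i => r i * r i).
  move=> i; have [sr r1 _] := rP i; split; last by rewrite anorm_sqr// r1 expr1n.
  by exists (r i); rewrite sr.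
have [sf0 f00 [y fE]] := fP 0%N (leq0n n).
pose d i := alpha (g i)^-1%g (w * x).
have rr (i j : 'I_n) : i != j -> r i * r j = 0.
  move=> ij; rewrite -scalerAl -scalerAr forth ?scaler0//; exact: ltn_ord.
have rf (i : 'I_n) : r i * f 0%N = 0.
  by rewrite -scalerAl forth ?scaler0//; exact: ltn_ord.
have aV (h : G) (u : A) : alpha h (alpha h^-1%g u) = u.
  by rewrite -actM mulgV act1.
split => //; first by exists x; rewrite /estarM /= invg1 !act1.
exists (f 0%N * f 0%N); split.
- by exists (f 0%N); rewrite /estarM /= invg1 !act1 sf0.
- by move=> ff0; apply: f00; apply: cube_eq0 => //; rewrite ff0 mul0r.
- apply: subset_closure; exists 1%N, (fun=> 1), (fun=> f 0%N * f 0%N).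
  split; last by rewrite big_ord1 scale1r.
  move=> _; exists (y * a * a * y) => //.
  by rewrite /emul /= !act1 fE !mulrA.
exists n, (fun i => (g i)^-1%g), (fun i => r i * d i); split.
- move=> i; apply: subset_closure.
  exists 1%N, (fun=> 1), (fun=> r i * d i).
  split; last by rewrite big_ord1 scale1r.
  have [_ _ [z zE]] := rP i.
  move=> _; exists (z * a * d i) => //.
  by rewrite /emull /= act1 zE !mulrA.
- rewrite [LHS]ax -[star x]mulr1 -wE.
  rewrite mulr_sumr mulr_suml mulr_sumr mulr_suml; apply: eq_bigr => i _.
  rewrite /estarM /= invgK -rmorphM !starM; have [sr _ _] := rP i.
  rewrite !rmorphM /= act_star !aV starM sw sr.
  by rewrite !mulrA.
- move=> i j ij; rewrite /= invgK starM.
  have [sr _ _] := rP i; rewrite -rmorphM sr -mulrA (mulrA (r i)) rr//.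
  by rewrite mul0r mulr0 rmorph0.
move=> i; rewrite /= invgK -rmorphM starM; have [sr _ _] := rP i.
by rewrite sr -mulrA (mulrA (r i)) rf mul0r mulr0 rmorph0.
Qed.

End Filling.

(** * Passage to quotient bundles *)

Section Quotient.
Variable R : realType.

Lemma qpi_norm_le (V : normedModType R[i]) (W : closedSubspace V) (v : V) :
  `|qpi W v| <= `|v|.
Proof.
have normE (u : V) : (complex.Re `|u|)%:C = `|u| by rewrite RRe_real ?normr_real.
rewrite -[leRHS]normE lecR; apply: ge_inf; last by exists v.
by exists 0 => _ [u _ <-]; rewrite -lecR normE (normr_ge0 u).
Qed.

(** The quotient map is linear and does not increase norms. *)
Lemma cspan_qpi (V : normedModType R[i]) (W : closedSubspace V) (X : set V)
    (Y : set (quotSpace W)) (v : V) :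
  (forall x, X x -> Y (qpi W x)) -> cspan X v -> cspan Y (qpi W v).
Proof.
move=> XY Xv U /nbhs_ballP[e /= e0 eU].
have [w [[n [c [x [Xx wE]]]] vw]] := Xv _ (nbhsx_ballx v _ e0).
exists (qpi W w); split.
  exists n, c, (fun i => qpi W (x i)); split => [i|]; first exact/XY.
  rewrite wE (big_morph _ (@qpiD _ _ W) (@qpi0 _ _ W)).
  by apply: eq_bigr => i _; rewrite qpiZ.
apply: eU; rewrite -ball_normE /=; move: vw; rewrite -ball_normE /=.
apply: le_lt_trans; have -> : qpi W v - qpi W w = qpi W (v - w).
  by rewrite -scaleN1r -qpiZ -qpiD scaleN1r.
exact: qpi_norm_le.
Qed.

Variables (G : groupType) (B : bundle R G) (J : bundle_ideal B).
Hypothesis J0 : forall (t : G) (x : B t), J t x -> x = 0.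

Let qpiK (t : G) (x : B t) : qrepr (qpi (J t) x) = x.
Proof. by apply/subr0_eq/J0/qpi_eq; rewrite qreprK. Qed.

Let qpi_eq0 (t : G) (x : B t) : qpi (J t) x = 0 -> x = 0.
Proof. by rewrite -(qpi0 (J t)) => /qpi_eq; rewrite subr0; exact: J0. Qed.

Let qpi_estarM (t : G) (x y : B t) :
  estarM (B := quot_bundle J) (qpi (J t) x) (qpi (J t) y) =
    qpi (J 1%g) (estarM x y).
Proof. by rewrite /estarM /= !qpiK. Qed.

Lemma strictly_infinite_quot0 (a : B 1%g) : strictly_infinite a ->
  strictly_infinite (B := quot_bundle J) (qpi (J 1%g) a).
Proof.
case=> -[x ax] a0 [b [[y yb] b0 bspan [k [t [z [zspan az zz zb]]]]]].
split; first by exists (qpi (J 1%g) x); rewrite qpi_estarM -ax.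
  by move=> /qpi_eq0.
exists (qpi (J 1%g) b); split.
- by exists (qpi (J 1%g) y); rewrite qpi_estarM -yb.
- by move=> /qpi_eq0.
- apply: cspan_qpi bspan => _ [c _ <-]; exists (qpi (J 1%g) c) => //.
  by rewrite /emul /= !qpiK.
exists k, t, (fun i => qpi (J (t i)) (z i)); split.
- move=> i; apply: cspan_qpi (zspan i) => _ [c _ <-].
  by exists (qpi (J (t i)) c) => //; rewrite /emull /= !qpiK.
- rewrite [in LHS]az (big_morph _ (@qpiD _ _ (J 1%g)) (@qpi0 _ _ (J 1%g))).
  by apply: eq_bigr => i _; rewrite qpi_estarM.
- by move=> i j ij; rewrite /= !qpiK zz// qpi0.
- by move=> i; rewrite /= !qpiK zb qpi0.
Qed.

End Quotient.

(** Multiplying by elements of the fibers over t and its inverse carries J t into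
    J 1, and shows that J 1 is an invariant ideal of A. *)
Lemma minimal_bundle_ideal (R : realType) (G : groupType) (A : cstarAlgType R)
    (alpha : action A G) (J : bundle_ideal (action_bundle alpha)) :
  minimal alpha ->
  (forall (t : G) (x : A), J t x -> x = 0) \/ (forall x : A, J 1%g x).
Proof.
move=> min.
have mull (s t u : G) (E : (s * t)%g = u) (a x : A) :
    J t x -> J u (a * alpha s x : A).
  move=> Jx; apply: (ideal_mull (s := s) (t := t) (E := E)); apply: subset_closure.
  exists 1%N, (fun=> 1), (fun=> a * alpha s x).
  by split; [move=> _; exists a => //; exists x | rewrite big_ord1 scale1r].
have mulr (s t u : G) (E : (s * t)%g = u) (x a : A) :
    J s x -> J u (x * alpha s a : A).
  move=> Jx; apply: (ideal_mulr (s := s) (t := t) (E := E)); apply: subset_closure.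
  exists 1%N, (fun=> 1), (fun=> x * alpha s a).
  by split; [move=> _; exists x => //; exists a | rewrite big_ord1 scale1r].
have [| | |J10|J1T] := min (J 1%g).
- by move=> a x Jx; have := mull _ _ _ (mulg1 1%g) a x Jx; rewrite act1.
- by move=> x a Jx; have := mulr _ _ _ (mulg1 1%g) x a Jx; rewrite act1.
- move=> t x Jx; have := mull _ _ _ (mulg1 t) 1 x Jx; rewrite mul1r => Jtx.
  by have := mulr _ _ _ (mulgV t) _ 1 Jtx; rewrite rmorph1 mulr1.
- left=> t x Jx; have := mulr _ _ _ (mulgV t) _ 1 Jx; rewrite rmorph1 mulr1.
  by rewrite -[J 1%g _]/(carrier (J 1%g) x) J10.
- by right=> x; rewrite -[J 1%g _]/(carrier (J 1%g) x) J1T.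
Qed.

Theorem lemma5p12 (R : realType) (G : groupType) (A : cstarAlgType R)
    (alpha : action A G) (n : nat) (n_ge2 : (2 <= n)%N)
    (alpha_filling : filling alpha n)
    (corner_infinite : forall p : A,
       projection p -> p <> 0 -> infinite_dimensional (corner p)) :
  minimal alpha /\
  (forall a : A, positive a -> a <> 0 ->
     strictly_infinite (B := action_bundle alpha) a /\
     residually_strictly_infinite (B := action_bundle alpha) a).
Proof.
have min := filling_minimal alpha_filling; split => // a pa a0.
have infa := filling_strictly_infinite alpha_filling corner_infinite pa a0.
split => // J; have [J0|J1] := minimal_bundle_ideal J min.
  by right; apply: strictly_infinite_quot0.
by left; rewrite -(qpi0 (J 1%g)); apply/qpi_eq; rewrite subr0.
Qed.
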